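(* Let $\alpha,\beta$ be positive real numbers and let $f_{\alpha,\beta}:(0,1]\to\mathbb{R}$ be a differentiable nonnegative function satisfying the functional equation $$f_{\alpha,\beta}(xy)=x^{\alpha}f_{\alpha,\beta}(y)+y^{\beta}f_{\alpha,\beta}(x)\qquad\text{for all } 0<x,y\le 1.$$ Then: (i) if $\alpha\neq\beta$, there is a nonnegative constant $c_{\alpha,\beta}$ (depending only on the parameters $\alpha,\beta$, i.e. not on $x$) such that $$f_{\alpha,\beta}(x)=c_{\alpha,\beta}\,\frac{x^{\beta}-x^{\alpha}}{\alpha-\beta}\qquad\text{for all } x\in(0,1];$$ (ii) if $\alpha=\beta$, there is a nonnegative constant $c_{\alpha}$ (depending only on $\alpha$, i.e. not on $x$) such that, writing $f_\alpha=f_{\alpha,\alpha}$, $$f_{\alpha}(x)=-c_{\alpha}\,x^{\alpha}\log x\qquad\text{for all } x\in(0,1].$$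
   Context: $\log$ is the natural logarithm. Differentiability on $(0,1]$ is understood as one-sided (left) differentiability at the endpoint $1$. *)

(* Defs.v *)
From Stdlib Require Import Reals.
Open Scope R_scope.

Definition unit_Ioc (x : R) : Prop := 0 < x <= 1.

(* The difference quotients are taken within D, so for D = (0,1] this is the
   usual derivative at interior points and the left derivative at 1, and values
   of f outside D play no role. *)
Definition differentiable_on (D : R -> Prop) (f : R -> R) : Prop :=
  exists f' : R -> R, forall x : R, D x -> D_in f f' D x.

(* Main.v *)
Require Import Defs.
From Stdlib Require Import Reals.
From Stdlib Require Import Lra Lia.
Open Scope R_scope.

(** For [alpha <> beta], exchanging [x] and [y] in the functional equation gives
    [f x * (y^beta - y^alpha) = f y * (x^beta - x^alpha)]; put [y = 1/2].
    For [alpha = beta], the function [t |-> f (exp (-t)) * exp (alpha * t)] is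
    additive and nonnegative for [t >= 0], hence monotone, hence linear. *)

Lemma additive_INR_mul (h : R -> R)
  (hadd : forall s t, 0 <= s -> 0 <= t -> h (s + t) = h s + h t)
  (n : nat) (t : R) : 0 <= t -> h (INR n * t) = INR n * h t.
Proof.
  intros Ht. induction n as [|n IH].
  - assert (H := hadd 0 0 (Rle_refl 0) (Rle_refl 0)).
    rewrite Rplus_0_l in H. simpl. rewrite !Rmult_0_l. lra.
  - rewrite S_INR, !Rmult_plus_distr_r, !Rmult_1_l, hadd, IH; auto.
    apply Rmult_le_pos; [apply pos_INR | assumption].
Qed.

(** Additivity and nonnegativity make [h] monotone. Comparing [n * t] with its two neighbouring
    integers then bounds [n] times the deviation from linearity by [h 1], uniformly in [n], so the
    deviation vanishes. *)
Lemma additive_nonneg_linear (h : R -> R)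
  (hadd : forall s t, 0 <= s -> 0 <= t -> h (s + t) = h s + h t)
  (hpos : forall t, 0 <= t -> 0 <= h t)
  (t : R) : 0 <= t -> h t = t * h 1.
Proof.
  intros Ht.
  assert (Hmono : forall u v, 0 <= u -> u <= v -> h u <= h v).
  { intros u v Hu Huv.
    replace v with (u + (v - u)) by ring.
    rewrite hadd by lra. assert (0 <= h (v - u)) by (apply hpos; lra). lra. }
  assert (Happrox : forall n : nat, INR n * Rabs (h t - t * h 1) <= h 1).
  { intros n.
    assert (Hn : 0 <= INR n * t) by (apply Rmult_le_pos; [apply pos_INR | lra]).
    (* [up r] is the integer with [r < up r <= r + 1], so [k = up (n * t) - 1] is the floor:
       [k <= n * t < k + 1]. *)
    destruct (archimed (INR n * t)) as [Hup Hup'].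
    assert (Hz : (0 <= up (INR n * t) - 1)%Z).
    { assert (0 < up (INR n * t))%Z by (apply lt_IZR; lra). lia. }
    destruct (IZN _ Hz) as [k Hk].
    assert (Hk' : INR k = IZR (up (INR n * t)) - 1)
      by (rewrite INR_IZR_INZ, <- Hk, minus_IZR; reflexivity).
    assert (Hlo : INR k * h 1 <= INR n * h t).
    { rewrite <- !(additive_INR_mul h hadd) by lra.
      apply Hmono; [apply Rmult_le_pos; [apply pos_INR | lra] | lra]. }
    assert (Hhi : INR n * h t <= INR (S k) * h 1).
    { rewrite <- !(additive_INR_mul h hadd) by lra.
      apply Hmono; [lra | rewrite S_INR; lra]. }
    rewrite S_INR in Hhi.
    assert (H1 : 0 <= h 1) by (apply hpos; lra).
    (* Both [n * h t] and [n * t * h 1] lie between [k * h 1] and [(k + 1) * h 1]. *)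
    rewrite <- (Rabs_pos_eq (INR n)) by apply pos_INR.
    rewrite <- Rabs_mult. apply Rabs_le. nra. }
  destruct (Req_dec (h t) (t * h 1)) as [|Hne]; [assumption | exfalso].
  assert (HD : 0 < Rabs (h t - t * h 1)) by (apply Rabs_pos_lt; lra).
  destruct (INR_archimed _ (h 1) HD) as [n Hn].
  specialize (Happrox n). lra.
Qed.

Lemma unit_Ioc_exp_opp (t : R) : 0 <= t -> unit_Ioc (exp (- t)).
Proof.
  intros Ht. split; [apply exp_pos |].
  rewrite <- exp_0.
  destruct Ht as [Ht | <-]; [left; apply exp_increasing; lra | rewrite Ropp_0; lra].
Qed.

(** Since the base is below 1, the power decreases in its exponent, so numerator and denominator
    have the same sign. *)
Lemma Rpower_half_sub_div_pos (a b : R) :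
  a <> b -> 0 < (Rpower (/ 2) b - Rpower (/ 2) a) / (a - b).
Proof.
  intros Hab. unfold Rpower.
  assert (Hl : ln (/ 2) < 0) by (rewrite <- ln_1; apply ln_increasing; lra).
  destruct (Rtotal_order a b) as [H | [H | H]]; [| lra |].
  - assert (exp (b * ln (/ 2)) < exp (a * ln (/ 2)))
      by (apply exp_increasing; nra).
    replace ((exp (b * ln (/ 2)) - exp (a * ln (/ 2))) / (a - b))
      with ((exp (a * ln (/ 2)) - exp (b * ln (/ 2))) / (b - a)) by (field; lra).
    apply Rdiv_lt_0_compat; lra.
  - assert (exp (a * ln (/ 2)) < exp (b * ln (/ 2)))
      by (apply exp_increasing; nra).
    apply Rdiv_lt_0_compat; lra.
Qed.

Theorem theorem3p2 (alpha beta : R) (f : R -> R)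
  (halpha : 0 < alpha) (hbeta : 0 < beta)
  (hdiff : differentiable_on unit_Ioc f)
  (hnonneg : forall x : R, unit_Ioc x -> 0 <= f x)
  (hfun : forall x y : R, unit_Ioc x -> unit_Ioc y ->
     f (x * y) = Rpower x alpha * f y + Rpower y beta * f x) :
  (alpha <> beta ->
     exists c : R, 0 <= c /\
       forall x : R, unit_Ioc x ->
         f x = c * ((Rpower x beta - Rpower x alpha) / (alpha - beta))) /\
  (alpha = beta ->
     exists c : R, 0 <= c /\
       forall x : R, unit_Ioc x ->
         f x = - c * Rpower x alpha * ln x).
Proof.
  split; intros Hab.
  - assert (Hhalf : unit_Ioc (/ 2)) by (split; lra).
    assert (Hd := Rpower_half_sub_div_pos alpha beta Hab).
    set (d := (Rpower (/ 2) beta - Rpower (/ 2) alpha) / (alpha - beta)) in Hd.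
    assert (Hd' : Rpower (/ 2) beta - Rpower (/ 2) alpha = d * (alpha - beta))
      by (unfold d; field; lra).
    (* The constant is forced by the claimed formula at [x = 1/2]; it is nonnegative because
       [d > 0]. *)
    exists (f (/ 2) / d). split.
    { apply Rle_mult_inv_pos; auto. }
    intros x Hx.
    assert (H1 := hfun x (/ 2) Hx Hhalf).
    assert (H2 := hfun (/ 2) x Hhalf Hx).
    rewrite (Rmult_comm (/ 2) x) in H2.
    assert (Hsym : f x * (d * (alpha - beta))
                   = f (/ 2) * (Rpower x beta - Rpower x alpha))
      by (rewrite <- Hd'; lra).
    apply (Rmult_eq_reg_r (d * (alpha - beta))).
    + rewrite Hsym. field. lra.
    + apply Rmult_integral_contrapositive; lra.
  - subst beta.
    (* With [x = exp (- t)], [h t] is [f x / x^alpha]. Dividing the functional equation by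
       [(x * y)^alpha] removes the weights, and the exponential turns products into sums. *)
    set (h := fun t => f (exp (- t)) * exp (alpha * t)).
    assert (hpos : forall t, 0 <= t -> 0 <= h t).
    { intros t Ht. apply Rmult_le_pos; [| apply Rlt_le, exp_pos].
      apply hnonneg, unit_Ioc_exp_opp, Ht. }
    assert (hadd : forall s t, 0 <= s -> 0 <= t -> h (s + t) = h s + h t).
    { intros s t Hs Ht. unfold h.
      rewrite Ropp_plus_distr, exp_plus, hfun by now apply unit_Ioc_exp_opp.
      unfold Rpower.
      rewrite !ln_exp, !Rmult_plus_distr_l, exp_plus, !Ropp_mult_distr_r_reverse,
        !exp_Ropp.
      field. split; apply Rgt_not_eq, exp_pos. }
    (* The constant is the slope of the linear function [h]. *)
    exists (h 1). split; [apply hpos; lra |].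
    intros x [Hx0 Hx1].
    assert (Hln : ln x <= 0).
    { rewrite <- ln_1. destruct Hx1 as [Hx1 | ->];
        [left; apply ln_increasing; lra | lra]. }
    assert (Hlin : h (- ln x) = - ln x * h 1)
      by (apply additive_nonneg_linear; auto; lra).
    (* Undoing the substitution at [t = - ln x], which is nonnegative as [x <= 1], recovers
       [f x]. *)
    replace (- h 1 * Rpower x alpha * ln x) with (h (- ln x) * Rpower x alpha)
      by (rewrite Hlin; ring).
    unfold h, Rpower.
    rewrite Ropp_involutive, exp_ln, Ropp_mult_distr_r_reverse, exp_Ropp by lra.
    field. apply Rgt_not_eq, exp_pos.
Qed.
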